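(* Let $k$ be a positive integer, $d$ a positive odd integer, and $i$ an integer with $1\leq i\leq d$. Then in $\mathcal{A}$ we have \[ \sum_{\substack{k_{1},\dots,k_{d}\geq1\\ k_{1}+\cdots+k_{d}=k}}2^{k_{i}}\zeta_{\mathcal{A}}(k_{1},\dots,k_{d})=0 \qquad\text{and}\qquad \sum_{\substack{k_{1},\dots,k_{d}\geq1\\ k_{1}+\cdots+k_{d}=k}}2^{k_{i}}\zeta_{\mathcal{A}}^{\star}(k_{1},\dots,k_{d})=0. \]
   Context: Let $\mathcal{A}:=\prod_{p}\mathbb{F}_{p}/\bigoplus_{p}\mathbb{F}_{p}$, where $p$ runs over all primes and $\mathbb{F}_p=\mathbb{Z}/p\mathbb{Z}$. For integers $k_1,\dots,k_d\geq1$ and a prime $p$ put $H_{p}(k_{1},\dots,k_{d}):=\sum_{0<n_{1}<\cdots<n_{d}<p}n_{1}^{-k_{1}}\cdots n_{d}^{-k_{d}}\in\mathbb{F}_p$ and $H_{p}^{\star}(k_{1},\dots,k_{d}):=\sum_{0<n_{1}\leq\cdots\leq n_{d}<p}n_{1}^{-k_{1}}\cdots n_{d}^{-k_{d}}\in\mathbb{F}_p$. The finite multiple zeta(-star) values are $\zeta_{\mathcal{A}}(k_{1},\dots,k_{d}):=(H_{p}(k_{1},\dots,k_{d}))_{p}\in\mathcal{A}$ and $\zeta_{\mathcal{A}}^{\star}(k_{1},\dots,k_{d}):=(H_{p}^{\star}(k_{1},\dots,k_{d}))_{p}\in\mathcal{A}$. *)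

(* Defs.v *)
From HB Require Import structures.
From mathcomp Require Import all_boot all_order all_algebra.
From mathcomp Require Import all_classical.

Set Implicit Arguments.
Unset Strict Implicit.
Unset Printing Implicit Defensive.

Import Order.TTheory GRing.Theory.
Local Open Scope ring_scope.

Definition prime_nat := {p : nat | prime p}.

Definition prodF := forall p : prime_nat, 'F_(sval p).

HB.instance Definition _ := gen_eqMixin prodF.
HB.instance Definition _ := gen_choiceMixin prodF.

Section ProductRing.

Let F_ext (x y : prodF) : (forall p, x p = y p) -> x = y.
Proof. exact: functional_extensionality_dep. Qed.

Definition prodF_zero : prodF := fun p => 0.
Definition prodF_opp (x : prodF) : prodF := fun p => - x p.
Definition prodF_add (x y : prodF) : prodF := fun p => x p + y p.
Definition prodF_one : prodF := fun p => 1.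
Definition prodF_mul (x y : prodF) : prodF := fun p => x p * y p.

Fact prodF_addA : associative prodF_add.
Proof. by move=> x y z; apply: F_ext => p; apply: addrA. Qed.
Fact prodF_addC : commutative prodF_add.
Proof. by move=> x y; apply: F_ext => p; apply: addrC. Qed.
Fact prodF_add0 : left_id prodF_zero prodF_add.
Proof. by move=> x; apply: F_ext => p; apply: add0r. Qed.
Fact prodF_addN : left_inverse prodF_zero prodF_opp prodF_add.
Proof. by move=> x; apply: F_ext => p; apply: addNr. Qed.

HB.instance Definition _ :=
  GRing.isZmodule.Build prodF prodF_addA prodF_addC prodF_add0 prodF_addN.

Fact prodF_mulA : associative prodF_mul.
Proof. by move=> x y z; apply: F_ext => p; apply: mulrA. Qed.
Fact prodF_mulC : commutative prodF_mul.
Proof. by move=> x y; apply: F_ext => p; apply: mulrC. Qed.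
Fact prodF_mul1 : left_id prodF_one prodF_mul.
Proof. by move=> x; apply: F_ext => p; apply: mul1r. Qed.
Fact prodF_mulDl : left_distributive prodF_mul prodF_add.
Proof. by move=> x y z; apply: F_ext => p; apply: mulrDl. Qed.
Fact prodF_one_neq0 : prodF_one != prodF_zero.
Proof.
apply/eqP => /(congr1 (fun x : prodF => x (exist _ 2 isT))) /eqP.
by rewrite oner_eq0.
Qed.

HB.instance Definition _ := GRing.Zmodule_isComNzRing.Build prodF
  prodF_mulA prodF_mulC prodF_mul1 prodF_mulDl prodF_one_neq0.

End ProductRing.

(* The direct sum, as the ideal of finitely supported elements. *)
Definition sumF (x : prodF) : bool :=
  `[< finite_set [set p : prime_nat | x p <> 0]%classic >].

Fact sumF_idealr : idealr_closed sumF.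
Proof.
split.
- apply/asboolP; rewrite (_ : mkset _ = set0) //.
  by apply/seteqP; split => p //=.
- apply/negP => /asboolP fin1.
  have: finite_set (@sval nat (fun p => prime p) @` [set: prime_nat])%classic.
    apply: finite_image; apply: sub_finite_set fin1 => p _ /=.
    by apply/eqP; rewrite (oner_neq0 'F_(sval p)).
  case/finite_seqP => s Es.
  have [p ltsp pr_p] := prime_above (\max_(n <- s) n)%N.
  have : (p \in s)%N.
    have : [set` s]%classic p by rewrite -Es; exists (exist _ p pr_p).
    by [].
  by move=> /(@leq_bigmax_seq _ _ xpredT id) /(_ isT); rewrite leqNgt ltsp.
- move=> a x y /asboolP finx /asboolP finy; apply/asboolP.
  have finU : finite_set ([set p | x p <> 0] `|` [set p | y p <> 0])%classic.
    by rewrite finite_setU.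
  apply: sub_finite_set finU => p /= axy.
  have [x0|/eqP xN0] := eqVneq (x p) 0; last by left.
  right => y0; apply: axy; rewrite -[LHS]/(a p * x p + y p).
  by rewrite x0 y0 mulr0 addr0.
Qed.

HB.instance Definition _ := isIdealr.Build prodF sumF sumF_idealr.

Definition calA := {ideal_quot (sumF : idealr prodF)}.
HB.instance Definition _ := GRing.ComNzRing.on calA.
HB.instance Definition _ := NzRingQuotient.on calA.

(* 'F_p is Z/pZ only for p prime, the only case used below. *)
Definition H_ (p d : nat) (k : 'I_d -> nat) : 'F_p :=
  \sum_(n : {ffun 'I_d -> 'I_p} |
      [forall j, (0 < n j)%N] &&
      [forall j : 'I_d, forall l : 'I_d, (j < l)%N ==> (n j < n l)%N])
    \prod_j (n j)%:R ^- k j.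

Definition Hstar (p d : nat) (k : 'I_d -> nat) : 'F_p :=
  \sum_(n : {ffun 'I_d -> 'I_p} |
      [forall j, (0 < n j)%N] &&
      [forall j : 'I_d, forall l : 'I_d, (j < l)%N ==> (n j <= n l)%N])
    \prod_j (n j)%:R ^- k j.

Definition zetaA (d : nat) (k : 'I_d -> nat) : calA :=
  \pi_calA%qT (fun p => H_ (sval p) k).

Definition zetaAstar (d : nat) (k : 'I_d -> nat) : calA :=
  \pi_calA%qT (fun p => Hstar (sval p) k).

(* Main.v *)
Require Import Defs.
From mathcomp Require Import all_boot all_order all_algebra.
From mathcomp Require Import qpoly finfield ring zify.
From mathcomp Require Import boolp classical_sets cardinality.

Set Implicit Arguments.
Unset Strict Implicit.
Unset Printing Implicit Defensive.

Import GRing.Theory.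
Local Open Scope ring_scope.

(** Fix a prime [p > k + 1] and work modulo [x^(k+1)] over [F_p].  With
    [u_m = x / (m - x)] and [v_m = 2 x / (m - 2 x)], the weighted sum at [p] is
    the coefficient of [x^k y^(i-1) w^(d-i)] in
      [T(y, w) = sum_n v_n * prod_(m < n) (1 + y u_m) * prod_(m > n) (1 + w u_m)],
    so for odd [d] it suffices that [T(y, w) + T(-y, -w) = 0].  Put [t = 2 x],
    [a = x (1 - y)], [b = x (1 - w)].  Since [prod_m (m - z) = z^(p-1) - 1],
    [T] is [- x] times the sum over [n] of
      [(1 + n / (n - t)) * prod_(m < n) (m - a) * prod_(m > n) (m - b)],
    and [(y, w) |-> (-y, -w)] is the reflection [(a, b) |-> (t - a, t - b)].
    The part without pole is explicit and killed by [x].  Let [E2(a)] be the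
    sum of the part with pole and its reflection.  Then
    [(t - 1 - a) E2(a + 1) = - a E2(a)], and going once around the [p] shifts
    gives [(t^p - t) E2(a) = 0], that is [t E2(a) = 0].

    The star version reduces to the other one: as [prod_m (1 + y u_m) = 1],
    complete symmetric sums of the [u_m] over an interval are, up to sign,
    elementary symmetric sums over its complement. *)

(** * Products over the prime field inside an algebra over it *)

Section PrimeProducts.

Variables (p : nat) (pr_p : prime p).

Lemma prod_Fp_nat (T : comNzRingType) (F : 'F_p -> T) :
  \prod_x F x = \prod_(0 <= j < p) F j%:R.
Proof.
pose G j := F j%:R; rewrite -/(G _).
transitivity (\prod_(0 <= j < (Zp_trunc (pdiv p)).+2) G j).
  by rewrite big_mkord; apply: eq_bigr => j _; rewrite /G natr_Zp.
by rewrite (Fp_cast pr_p).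
Qed.

Variables (R : comNzRingType) (iota : {rmorphism 'F_p -> R}).

Lemma pchar_iota : p \in [pchar R].
Proof. exact: rmorph_pchar (pchar_Fp pr_p). Qed.

Lemma prod_subr_nat (z : R) : \prod_(0 <= j < p) (z - j%:R) = z ^+ p - z.
Proof.
have := finField_genPoly 'F_p; rewrite card_Fp // prod_Fp_nat.
move=> /(congr1 (fun q => (map_poly iota q).[z])).
rewrite rmorphB /= map_polyXn map_polyX hornerD hornerN hornerXn hornerX => ->.
rewrite rmorph_prod horner_prod; apply: eq_bigr => j _.
by rewrite rmorphB /= map_polyX map_polyC /= rmorph_nat hornerXsubC.
Qed.

Lemma frobeniusB (a b : R) : (a - b) ^+ p = a ^+ p - b ^+ p.
Proof.
have := rmorphB (pFrobenius_aut pchar_iota) a b.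
by rewrite /= !pFrobenius_autE.
Qed.

End PrimeProducts.

(** * Partial products and the part without pole *)

Definition prodlt (R : comNzRingType) (n : nat) (a : R) : R :=
  \prod_(1 <= m < n) (m%:R - a).
Definition prodgt (R : comNzRingType) (p n : nat) (b : R) : R :=
  \prod_(n.+1 <= m < p) (m%:R - b).

Section Kernel.

Variables (p : nat) (pr_p : prime p) (odd_p : odd p).
Let p_gt1 : (1 < p)%N := prime_gt1 pr_p.

(** For odd [p] and in an algebra over ['F_p], this is minus the complete homogeneous polynomial of
    degree [p - 2], see [prodsumE]. *)
Definition prodsum (R : comNzRingType) (a b : R) : R :=
  \sum_(1 <= n < p) prodlt n a * prodgt p n b.

Lemma even_expN (R : comNzRingType) (a : R) : (- a) ^+ p.-1 = a ^+ p.-1.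
Proof. by rewrite exprNn -signr_odd; case: (p) odd_p => //= q /negPf->; rewrite mul1r. Qed.

Section Products.
Variables (R : comNzRingType) (iota : {rmorphism 'F_p -> R}).

(* Cancelling [a] in [prod_subr_nat] is legitimate once [a] is a variable. *)
Lemma prodlt_full (a : R) : prodlt p a = a ^+ p.-1 - 1.
Proof.
pose iota' : {rmorphism 'F_p -> {poly R}} := polyC \o iota.
have /esym := prod_subr_nat pr_p iota' 'X.
rewrite big_ltn ?(ltnW p_gt1) // subr0 -[in 'X^p](prednK (ltnW p_gt1)) exprS.
rewrite (_ : _ - _ = 'X * ('X ^+ p.-1 - 1)); last by rewrite mulrBr mulr1.
move=> /(monic_lreg (monicX R)).
move=> /(congr1 (fun q => q.[a])); rewrite hornerD hornerN hornerXn hornerC => ->.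
rewrite horner_prod /prodlt.
transitivity (\prod_(1 <= m < p) (-1 * (a - m%:R))).
  by apply: eq_bigr => m _; rewrite mulN1r opprB.
rewrite big_split /= prodr_const_nat subn1 even_expN expr1n mul1r.
apply: eq_bigr => m _; rewrite hornerD hornerN hornerX.
by rewrite -polyC_natr hornerC.
Qed.

Lemma prodltS n (a : R) : (0 < n)%N -> prodlt n.+1 a = prodlt n a * (n%:R - a).
Proof. by move=> n_gt0; rewrite /prodlt big_nat_recr. Qed.

Lemma prodgtS n (b : R) : (0 < n < p)%N ->
  prodgt p n.-1 b = (n%:R - b) * prodgt p n b.
Proof. by case: n => //= n n_lt; rewrite /prodgt big_ltn. Qed.

Lemma prodlt_gt n (a : R) : (0 < n < p)%N ->
  prodlt n a * (n%:R - a) * prodgt p n a = prodlt p a.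
Proof.
case/andP=> n_gt0 ltnp; rewrite -prodltS // /prodlt /prodgt.
by rewrite [RHS](@big_cat_nat _ _ _ n.+1).
Qed.

(** Writing [b - a] as [(n - a) - (n - b)] turns each term into a difference of consecutive values
    of [g], which runs from the full product in [b] to the full product in [a]. *)
Lemma prodsum_telescope (a b : R) :
  (b - a) * prodsum a b = a ^+ p.-1 - b ^+ p.-1.
Proof.
pose g n := prodlt n a * prodgt p n.-1 b.
transitivity (g p - g 1%N); last first.
  have -> : g p = prodlt p a.
    by rewrite /g /prodgt big_geq ?mulr1 // prednK ?(ltnW p_gt1).
  have -> : g 1%N = prodlt p b by rewrite /g /prodlt big_geq ?mul1r.
  by rewrite !prodlt_full; ring.
rewrite -(telescope_sumr _ (ltnW p_gt1)) mulr_sumr; apply: eq_big_nat => n n_lt.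
by rewrite /g /= (prodgtS b n_lt) (prodltS a (proj1 (andP n_lt))); ring.
Qed.

(** As [m - (a + 1) = (m - 1) - a], the factors move down one place: [- a] enters and [n - 1 - a]
    leaves. *)
Lemma prodlt_shift n (a : R) : (0 < n)%N ->
  (n%:R - 1 - a) * prodlt n (a + 1) = - a * prodlt n a.
Proof.
elim: n => // -[_ _|n IHn _]; first by rewrite /prodlt !big_geq //; ring.
rewrite (prodltS (a + 1)) // (prodltS a) // [RHS]mulrA -IHn //.
by rewrite -[n.+2%:R]natr1; ring.
Qed.

End Products.

Lemma horner_prodsum (R : comNzRingType) (a b : R) :
  (prodsum a%:P 'X).[b] = prodsum a b.
Proof.
rewrite /prodsum horner_sum; apply: eq_bigr => n _.
rewrite hornerM /prodlt /prodgt !horner_prod; congr (_ * _); apply: eq_bigr => m _;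
  by rewrite hornerD hornerN ?hornerC ?hornerX -polyC_natr hornerC.
Qed.

(** * The part with pole: shift and reflection *)

Section PoleSums.
Variables (R : comNzRingType) (iota : {rmorphism 'F_p -> R}).

(* This formula and the next follow from the telescoping identity once [b] is a variable,
   since [b - a] is then regular. *)
Lemma prodsumE (a b : R) :
  prodsum a b = - \sum_(i < p.-1) a ^+ (p.-2 - i) * b ^+ i.
Proof.
pose iota' : {rmorphism 'F_p -> {poly R}} := polyC \o iota.
suff /(congr1 (fun q => q.[b])): prodsum a%:P 'X =
    - \sum_(i < p.-1) (a%:P) ^+ (p.-2 - i) * 'X ^+ i :> {poly R}.
  rewrite horner_prodsum hornerN horner_sum => ->; congr (- _).
  by apply: eq_bigr => i _; rewrite hornerM -polyC_exp hornerC hornerXn.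
apply: (monic_lreg (monicXsubC a)); rewrite (prodsum_telescope iota').
by rewrite mulrN -mulNr opprB subrXX_comm //; apply: mulrC.
Qed.

Lemma mul_prodsum (a b : R) : a * prodsum a b = b ^+ p.-1 - (a - b) ^+ p.-1.
Proof.
pose iota' : {rmorphism 'F_p -> {poly R}} := polyC \o iota.
suff /(congr1 (fun q => q.[b])): a%:P * prodsum a%:P 'X =
    'X ^+ p.-1 - ('X - a%:P) ^+ p.-1 :> {poly R}.
  rewrite hornerM hornerC horner_prodsum => ->.
  rewrite hornerD hornerN !horner_exp hornerX hornerXsubC.
  by rewrite -[a - b]opprB even_expN.
apply: (monic_lreg (monicXsubC a)); rewrite mulrCA (prodsum_telescope iota').
rewrite !mulrBr -[in RHS]exprS prednK ?(ltnW p_gt1) // (frobeniusB pr_p iota').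
rewrite mulrBl -!exprS prednK ?(ltnW p_gt1) //; ring.
Qed.

Variables (t : R) (W : nat -> R).
Hypothesis W_inv : forall n, (0 < n < p)%N -> (n%:R - t) * W n = 1.

Definition poleSum (a b : R) : R :=
  \sum_(1 <= n < p) n%:R * W n * (prodlt n a * prodgt p n b).
Definition weightSum (a b : R) : R :=
  \sum_(1 <= n < p) n%:R * (prodlt n a * prodgt p n b).

(** By [prodlt_shift], [n * prodlt n (a + 1)] is [(a + 1) * prodlt n (a + 1) - a * prodlt n a],
    which leaves two instances of [mul_prodsum]. *)
Lemma weightSumE (a b : R) :
  weightSum (a + 1) b = (a - b) ^+ p.-1 - (a + 1 - b) ^+ p.-1.
Proof.
transitivity ((a + 1) * prodsum (a + 1) b - a * prodsum a b); last first.
  by rewrite !mul_prodsum; ring.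
rewrite /weightSum /prodsum !mulr_sumr -sumrB; apply: eq_big_nat => n /andP[n_gt0 _].
have /eqP := prodlt_shift a n_gt0; rewrite mulNr -subr_eq0 opprK => /eqP E.
rewrite -[LHS]subr0 -[0 in LHS](mul0r (prodgt p n b)) -E; ring.
Qed.

(** Split [t - 1 - a] as [(n - 1 - a) - (n - t)]: the first part undoes the shift, the second
    cancels the pole. *)
Lemma poleSum_shift (a b : R) :
  (t - 1 - a) * poleSum (a + 1) b = - a * poleSum a b - weightSum (a + 1) b.
Proof.
rewrite /poleSum /weightSum !mulr_sumr -sumrB; apply: eq_big_nat => n n_lt.
have E := prodlt_shift a (proj1 (andP n_lt)); have V := W_inv n_lt.
transitivity (n%:R * W n * prodgt p n b * (- a * prodlt n a)
  - ((n%:R - t) * W n) * n%:R * (prodlt n (a + 1) * prodgt p n b)).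
  by rewrite -E; ring.
by rewrite V; ring.
Qed.

Definition poleSum2 (a b : R) : R := poleSum a b + poleSum (t - a) (t - b).

(** The reflection runs the shift backwards, so its equation is taken at [t - a - 1]. Since [p - 1]
    is even, the two [weightSum] corrections are opposite and cancel. *)
Lemma poleSum2_shift (a b : R) :
  (t - 1 - a) * poleSum2 (a + 1) b = - a * poleSum2 a b.
Proof.
have E1 := poleSum_shift a b; have E2 := poleSum_shift (t - a - 1) (t - b).
rewrite weightSumE in E1; rewrite weightSumE subrK in E2.
have e1 : t - a - 1 - (t - b) = - (a + 1 - b) by ring.
have e2 : t - a - (t - b) = - (a - b) by ring.
rewrite e1 e2 !even_expN in E2.
have e3 : t - (a + 1) = t - a - 1 by ring.
rewrite /poleSum2 mulrDr E1 mulrDr e3.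
have -> : (t - 1 - a) * poleSum (t - a - 1) (t - b) =
   - (- (t - a - 1) * poleSum (t - a - 1) (t - b)) by ring.
have -> : - (t - a - 1) * poleSum (t - a - 1) (t - b) =
  (t - 1 - (t - a - 1)) * poleSum (t - a) (t - b) +
   ((- (a + 1 - b)) ^+ p.-1 - (- (a - b)) ^+ p.-1).
  by rewrite E2 !even_expN; ring.
by rewrite !even_expN; ring.
Qed.

Lemma poleSum2_iter (a b : R) N :
  (\prod_(0 <= j < N) (t - 1 - a - j%:R)) * poleSum2 (a + N%:R) b =
  (\prod_(0 <= j < N) (- a - j%:R)) * poleSum2 a b.
Proof.
elim: N => [|N IHN]; first by rewrite !big_geq // addr0.
rewrite !big_nat_recr //= -natr1 addrA -mulrA.
have -> : t - 1 - a - N%:R = t - 1 - (a + N%:R) by ring.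
rewrite poleSum2_shift mulrCA IHN; ring.
Qed.

(** After [p] shifts [a] is back at itself. By Frobenius the two accumulated products differ by
    [t^p - t], which is [- t] here. *)
Lemma poleSum2_eq0 (a b : R) : t ^+ p.-1 = 0 -> t * poleSum2 a b = 0.
Proof.
move=> t0; have := poleSum2_iter a b p.
have F := frobeniusB pr_p iota.
rewrite (pcharf0 (pchar_iota pr_p iota)) addr0 !(prod_subr_nat pr_p iota).
have -> : (- a) ^+ p = - a ^+ p.
  by rewrite -sub0r F expr0n eqn0Ngt (ltnW p_gt1) sub0r.
rewrite !F expr1n.
have -> : t ^+ p = 0 by rewrite -(prednK (ltnW p_gt1)) exprS t0 mulr0.
move/eqP; rewrite -subr_eq0 => /eqP E.
by rewrite -[RHS]oppr0 -E /=; ring.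
Qed.

End PoleSums.
End Kernel.

(** * Oddness of the generating function [T] *)

Section GeneratingFunction.

Variables (p : nat) (pr_p : prime p) (odd_p : odd p).
Variables (R : comNzRingType) (iota : {rmorphism 'F_p -> R}).
Variables (x : R) (u v : nat -> R).
Hypothesis x_nil : x ^+ p.-1 = 0.
Hypothesis uE : forall m, (0 < m < p)%N -> (m%:R - x) * u m = x.
Hypothesis vE : forall m, (0 < m < p)%N -> (m%:R - 2 * x) * v m = 2 * x.

Definition splitGen (y w : R) : R :=
  \sum_(1 <= n < p) v n * \prod_(1 <= m < n) (1 + y * u m)
                        * \prod_(n.+1 <= m < p) (1 + w * u m).

Let W (n : nat) : R := - (prodlt n (2 * x) * prodgt p n (2 * x)).

(** The factor [n - z] divides the full product [z^(p-1) - 1 = -1], so the other factors, negated,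
    form its inverse. *)
Lemma nil_inv n (z : R) : (0 < n < p)%N -> z ^+ p.-1 = 0 ->
  (n%:R - z) * - (prodlt n z * prodgt p n z) = 1.
Proof.
move=> n_lt z0; have := prodlt_gt z n_lt.
rewrite (prodlt_full pr_p odd_p iota) z0 sub0r => E.
by apply: oppr_inj; rewrite -[RHS]E; ring.
Qed.

Let x2_nil : (2 * x) ^+ p.-1 = 0.
Proof. by rewrite exprMn x_nil mulr0. Qed.

(** Every term of [prodsumE] has degree [p - 2], so one more [x] completes [x^(p-1) = 0]. *)
Lemma mul_prodsum_nil (c e : R) : x * prodsum p (x * c) (x * e) = 0.
Proof.
rewrite (prodsumE pr_p odd_p iota) mulrN mulr_sumr big1 ?oppr0 // => i _.
have i_le : (i <= p.-2)%N by have := ltn_ord i; have := prime_gt1 pr_p; lia.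
rewrite !exprMn.
have -> : x * (x ^+ (p.-2 - i) * c ^+ (p.-2 - i) * (x ^+ i * e ^+ i)) =
    x * x ^+ (p.-2 - i + i) * (c ^+ (p.-2 - i) * e ^+ i) by rewrite exprD; ring.
rewrite subnK // -exprS prednK ?x_nil ?mul0r //.
by have := prime_gt1 pr_p; have := odd_p; case: (p) => [|[|[]]].
Qed.

(** By [uE], [(m - x) * (1 + y * u m) = m - a], and likewise with [w] and [b]; multiplying by
    expressions equal to 1 clears all denominators but [n - 2 * x]. *)
Lemma splitGenE (y w : R) (a := x * (1 - y)) (b := x * (1 - w)) :
  splitGen y w = - x * (prodsum p a b + poleSum p W a b).
Proof.
rewrite /prodsum /poleSum -big_split /= mulr_sumr; apply: eq_big_nat => n n_lt.
have [n_gt0 ltnp] := andP n_lt.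
set L := \prod_(1 <= m < n) _; set G := \prod_(n.+1 <= m < p) _.
have EL : prodlt n a = prodlt n x * L.
  rewrite /prodlt -big_split /=; apply: eq_big_nat => m m_lt.
  transitivity (m%:R - x + y * x); first by rewrite /a; ring.
  by rewrite -{2}(@uE m); [ring | lia].
have EG : prodgt p n b = prodgt p n x * G.
  rewrite /prodgt -big_split /=; apply: eq_big_nat => m m_lt.
  transitivity (m%:R - x + w * x); first by rewrite /b; ring.
  by rewrite -{2}(@uE m); [ring | lia].
have I := nil_inv n_lt x_nil; have J : (n%:R - 2 * x) * W n = 1 by apply: nil_inv.
transitivity (((n%:R - x) * - (prodlt n x * prodgt p n x)) *
   (((n%:R - 2 * x) * W n) * (v n * L * G))); first by rewrite I J !mul1r.
transitivity (((n%:R - 2 * x) * v n) * W n *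
    ((n%:R - x) * - (prodlt n x * L * (prodgt p n x * G)))); first by ring.
rewrite -EL -EG vE //=.
(* Writing [2 * (n - x)] as [(n - 2 * x) + n] separates the part without pole. *)
transitivity (- x * (((n%:R - 2 * x) * W n) + n%:R * W n) * (prodlt n a * prodgt p n b)).
  by ring.
by rewrite J; ring.
Qed.

(** The factor 2 is there because [poleSum2_eq0] is applied with [t = 2 * x], whereas [splitGenE]
    only provides [x]. *)
Lemma splitGen_odd (y w : R) : 2 * (splitGen y w + splitGen (- y) (- w)) = 0.
Proof.
have W_inv n : (0 < n < p)%N -> (n%:R - 2 * x) * W n = 1.
  by move=> n_lt; apply: nil_inv.
have := poleSum2_eq0 pr_p odd_p iota W_inv (x * (1 - y)) (x * (1 - w)) x2_nil.
rewrite /poleSum2.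
have reflect z : 2 * x - x * (1 - z) = x * (1 - - z) by ring.
rewrite !reflect => E.
have s1 := mul_prodsum_nil (1 - y) (1 - w).
have s2 := mul_prodsum_nil (1 - - y) (1 - - w).
rewrite !splitGenE -[RHS]subr0 -[X in _ = _ - X]E -[X in _ = X - _](mulr0 (- 2)).
by rewrite -[X in _ = _ * X - _]addr0 -{1}s1 -s2; ring.
Qed.

(** Multiplying by the full product of the [m - x] gives that of the [m - x * (1 - y)]; both are -1
    by nilpotency. *)
Lemma prod_u_eq1 (y : R) : \prod_(1 <= m < p) (1 + y * u m) = 1.
Proof.
have E : prodlt p (x * (1 - y)) = prodlt p x * \prod_(1 <= m < p) (1 + y * u m).
  rewrite /prodlt -big_split /=; apply: eq_big_nat => m m_lt.
  transitivity (m%:R - x + y * x); first by ring.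
  by rewrite -{2}(@uE m); [ring | lia].
move: E; rewrite !(prodlt_full pr_p odd_p iota) exprMn x_nil mul0r sub0r mulN1r.
by move/oppr_inj.
Qed.

End GeneratingFunction.

(** * Nested sums as coefficients of products *)

Section NestedSums.

Variable R : comNzRingType.

(* Peels off the largest summation index; [e = 0] gives strict chains
   [n_1 < ... < n_d < N] and [e = 1] weak chains [n_1 <= ... <= n_d < N]. *)
Fixpoint nest (e : nat) (g : nat -> nat -> R) (d N : nat) : R :=
  if d is d'.+1 then \sum_(1 <= n < N) g d' n * nest e g d' (n + e) else 1.

Definition chain (e p d : nat) (n : {ffun 'I_d -> 'I_p}) : bool :=
  [forall j, (0 < n j)%N] &&
  [forall j : 'I_d, forall l : 'I_d, (j < l)%N ==> (n j < n l + e)%N].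

Definition ffun_rcons (p d : nat) (q : 'I_p * {ffun 'I_d -> 'I_p}) :
    {ffun 'I_d.+1 -> 'I_p} :=
  [ffun j => if unlift ord_max j is Some j' then q.2 j' else q.1].

Lemma ffun_rcons_max p d (q : 'I_p * {ffun 'I_d -> 'I_p}) :
  ffun_rcons q ord_max = q.1.
Proof. by rewrite ffunE unlift_none. Qed.

Lemma ffun_rcons_lift p d (q : 'I_p * {ffun 'I_d -> 'I_p}) j :
  ffun_rcons q (lift ord_max j) = q.2 j.
Proof. by rewrite ffunE liftK. Qed.

Lemma ffun_rcons_bij p d : bijective (@ffun_rcons p d).
Proof.
exists (fun n : {ffun 'I_d.+1 -> 'I_p} =>
  (n ord_max, [ffun j : 'I_d => n (lift ord_max j)])).
  move=> [m q]; rewrite ffun_rcons_max; congr (_, _).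
  by apply/ffunP => j; rewrite ffunE ffun_rcons_lift.
move=> n; apply/ffunP => j; rewrite ffunE.
by case: unliftP => [j' ->|->] //=; rewrite ffunE.
Qed.

Lemma chain_rcons e p d N (q : 'I_p * {ffun 'I_d -> 'I_p}) : (e <= 1)%N ->
  chain e (ffun_rcons q) && [forall j, (ffun_rcons q j < N)%N] =
  (0 < q.1 < N)%N && (chain e q.2 && [forall j, (q.2 j < q.1 + e)%N]).
Proof.
move=> e_le1; apply/andP/andP.
  case=> /andP[/forallP pos /forallP inc] /forallP bnd; split.
    by have := pos ord_max; have := bnd ord_max; rewrite ffun_rcons_max => -> ->.
  apply/andP; split; first (apply/andP; split).
  - by apply/forallP => j; have := pos (lift ord_max j); rewrite ffun_rcons_lift.
  - apply/forallP => j; apply/forallP => l; apply/implyP => ltjl.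
    have /forallP/(_ (lift ord_max l))/implyP := inc (lift ord_max j).
    by rewrite !ffun_rcons_lift !lift_max => /(_ ltjl).
  - apply/forallP => j.
    have /forallP/(_ ord_max)/implyP := inc (lift ord_max j).
    by rewrite ffun_rcons_lift ffun_rcons_max lift_max => /(_ (ltn_ord j)).
case=> /andP[pos1 bnd1] /andP[/andP[/forallP pos /forallP inc] /forallP bnd].
(* From [q.2 j < q.1 + e] and [q.1 < N], using [e <= 1]. *)
have bnd' j : (q.2 j < N)%N by have := bnd j; lia.
split; last first.
  apply/forallP => j; case: (unliftP ord_max j) => [j' ->|->].
    by rewrite ffun_rcons_lift.
  by rewrite ffun_rcons_max.
apply/andP; split; apply/forallP => j.
  case: (unliftP ord_max j) => [j' ->|->]; first by rewrite ffun_rcons_lift.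
  by rewrite ffun_rcons_max.
apply/forallP => l; apply/implyP.
case: (unliftP ord_max j) => [j' ->|->]; last first.
  by have := ltn_ord l; rewrite /= ltnS ltnNge => ->.
rewrite lift_max ffun_rcons_lift.
case: (unliftP ord_max l) => [l' ->|->]; last by rewrite ffun_rcons_max.
rewrite lift_max ffun_rcons_lift => ltjl.
by have /forallP/(_ l')/implyP/(_ ltjl) := inc j'.
Qed.

(** The bound [N] is there for the induction: below the largest index [m] remains a chain bounded by
    [m + e]. *)
Lemma sum_chain_bounded e (g : nat -> nat -> R) p d N : (e <= 1)%N -> (N <= p)%N ->
  \sum_(n : {ffun 'I_d -> 'I_p} | chain e n && [forall j, (n j < N)%N])
     \prod_(j < d) g j (n j) = nest e g d N.
Proof.
move=> e_le1; elim: d N => [|d IHd] N leNp.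
  rewrite (big_pred1 (ffun0 (card_ord 0))) ?big_ord0 // => n /=.
  have -> : n = ffun0 (card_ord 0) by apply/ffunP; case.
  by rewrite eqxx /chain; apply/andP; split; [apply/andP; split|];
    apply/forallP; case.
rewrite (reindex (@ffun_rcons p d)) /=; last exact/onW_bij/ffun_rcons_bij.
under eq_bigl do rewrite chain_rcons //.
under eq_bigr => q _.
  rewrite big_ord_recr ffun_rcons_max /=.
  under eq_bigr => j _.
    rewrite (_ : widen_ord _ j = lift ord_max j) ?ffun_rcons_lift; last first.
      by apply: val_inj; exact/esym/lift_max.
    over.
  over.
rewrite -(pair_big_dep (fun m : 'I_p => 0 < m < N)%N
   (fun m (q : {ffun 'I_d -> 'I_p}) => chain e q && [forall j, (q j < m + e)%N])
   (fun m q => (\prod_(j < d) g j (q j)) * g d m)) /=.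
rewrite (big_nat_widen _ _ _ _ _ leNp) big_geq_mkord.
apply: eq_big => [m|m /andP[m_gt0 m_lt]]; first by rewrite andbC.
by rewrite -mulr_suml IHd; [rewrite mulrC | lia].
Qed.

Lemma sum_chain e (g : nat -> nat -> R) p d : (e <= 1)%N ->
  \sum_(n : {ffun 'I_d -> 'I_p} | chain e n) \prod_(j < d) g j (n j) = nest e g d p.
Proof.
move=> e_le1; rewrite -(sum_chain_bounded g d e_le1 (leqnn p)).
apply: eq_bigl => n; rewrite (_ : [forall j, _]) ?andbT //.
by apply/forallP => j; apply: ltn_ord.
Qed.

(** Generating polynomial of the elementary symmetric sums of the [u l]. *)
Definition genU (u : nat -> R) (m n : nat) : {poly R} := \prod_(m <= l < n) (1 + u l *: 'X).

Lemma coef_genU0 u m n : (genU u m n)`_0 = 1.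
Proof.
rewrite -horner_coef0 /genU horner_prod big1 // => l _.
by rewrite hornerD hornerZ hornerX mulr0 hornerC addr0.
Qed.

Lemma coef_genUr u m n r : (m <= n)%N ->
  (genU u m n.+1)`_r.+1 = (genU u m n)`_r.+1 + u n * (genU u m n)`_r.
Proof.
move=> lemn; rewrite /genU big_nat_recr //= mulrDr mulr1 coefD -scalerAr coefZ.
by rewrite coefMX.
Qed.

Lemma genUl u m n : (m < n)%N -> genU u m n = (1 + u m *: 'X) * genU u m.+1 n.
Proof. by move=> ltmn; rewrite /genU big_ltn. Qed.

Lemma coef_genUl (c : R) (q : {poly R}) r :
  ((1 + c *: 'X) * q)`_r.+1 = q`_r.+1 + c * q`_r.
Proof. by rewrite mulrDl mul1r coefD -scalerAl coefZ coefXM. Qed.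

Variables (u v : nat -> R) (i : nat).

Let g (j m : nat) : R := if j == i then v m else u m.

Let g_eq m : g i m = v m.
Proof. by rewrite /g eqxx. Qed.

Let g_neq j m : j != i -> g j m = u m.
Proof. by rewrite /g => /negPf->. Qed.

Lemma nest_strict_prefix r N : (0 < N)%N -> (r <= i)%N -> nest 0 g r N = (genU u 1 N)`_r.
Proof.
case: N => // N _; elim: N r => [|N IHN] [|r] r_le.
- by rewrite coef_genU0.
- by rewrite /= big_geq // /genU big_geq // coef1.
- by rewrite coef_genU0.
rewrite coef_genUr // -!IHN ?(ltnW r_le) //= big_nat_recr //= addn0.
by rewrite g_neq // ltn_eqF.
Qed.

(** The index [n] at position [i] splits a strict chain into [i] indices below [n] and [s] above
    it. *)
Lemma nest_strict s N :
  nest 0 g (i.+1 + s) N =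
  \sum_(1 <= n < N) v n * (genU u 1 n)`_i * (genU u n.+1 N)`_s.
Proof.
case: N => [|N]; first by rewrite addSn /= !big_geq.
elim: N s => [|N IHN] [|s]; try by rewrite addSn /= !big_geq.
  rewrite addn0 /=; apply: eq_big_nat => n /andP[n_gt0 _].
  by rewrite coef_genU0 mulr1 addn0 nest_strict_prefix // g_eq.
have -> : nest 0 g (i.+1 + s.+1) N.+2 =
    nest 0 g (i.+1 + s.+1) N.+1 + u N.+1 * nest 0 g (i.+1 + s) N.+1.
  rewrite addnS /= big_nat_recr //= addn0 g_neq //; lia.
rewrite !IHN.
have G0 : (genU u N.+2 N.+2)`_s.+1 = 0 by rewrite /genU big_geq // coef1.
rewrite [RHS]big_nat_recr //= G0 mulr0 addr0.
rewrite mulr_sumr -big_split /=; apply: eq_big_nat => n n_lt.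
rewrite (@coef_genUr _ _ N.+1); last by lia.
by rewrite mulrDr; congr (_ + _); rewrite mulrCA.
Qed.

Variable p : nat.
Hypothesis genU_full : genU (\- u) 1 p = 1.

(* The complete symmetric sum over [1 <= l < N] is, up to sign, the elementary
   one over the complementary range, because the full product is 1. *)
Lemma nest_weak_prefix r N : (0 < N <= p)%N -> (r <= i)%N ->
  nest 1 g r N = (genU (\- u) N p)`_r.
Proof.
move=> N_le r_le; elim: r r_le N N_le => [|r IHr] r_le; first by move=> N _; rewrite coef_genU0.
case=> // N; elim: N => [|N IHN] N_lt; first by rewrite /= big_geq // genU_full coef1.
have -> : nest 1 g r.+1 N.+2 = nest 1 g r.+1 N.+1 + u N.+1 * nest 1 g r N.+2.
  by rewrite /= big_nat_recr //= addn1 g_neq // ltn_eqF.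
rewrite IHr ?(ltnW r_le) // IHN ?(ltnW N_lt) // genUl // coef_genUl /=; ring.
Qed.

(** Splitting at [n] leaves complete sums over [[1, n]] and [[n, N)]. The complementary ranges are
    [[n + 1, p)] for the first, and [[1, n)] with [[N, p)] for the second. *)
Lemma nest_weak s N : (0 < N <= p)%N ->
  nest 1 g (i.+1 + s) N = \sum_(1 <= n < N)
    v n * (genU (\- u) n.+1 p)`_i * (genU (\- u) 1 n * genU (\- u) N p)`_s.
Proof.
elim: s N => [|s IHs] [|N] // N_le.
  rewrite addn0 /=; apply: eq_big_nat => n n_lt.
  rewrite coef0M !coef_genU0 !mulr1 addn1 nest_weak_prefix ?g_eq //; lia.
elim: N N_le => [|N IHN] N_le; first by rewrite addSn /= !big_geq.
have -> : nest 1 g (i.+1 + s.+1) N.+2 =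
    nest 1 g (i.+1 + s.+1) N.+1 + u N.+1 * nest 1 g (i.+1 + s) N.+2.
  rewrite addnS /= big_nat_recr //= addn1 g_neq //; lia.
rewrite IHs // IHN ?(ltnW N_le) // mulr_sumr.
rewrite !(@big_nat_recr _ _ _ N.+1 1) //= addrA -big_split /=; congr (_ + _).
  apply: eq_big_nat => n n_lt; rewrite [genU _ N.+1 p]genUl // mulrCA coef_genUl /=.
  ring.
(* The full product is 1, so its coefficient of positive degree vanishes; this accounts for the new
   term [n = N.+1]. *)
have: (genU (\- u) 1 N.+1 * genU (\- u) N.+1 p)`_s.+1 = 0.
  suff -> : genU (\- u) 1 N.+1 * genU (\- u) N.+1 p = 1 by rewrite coef1.
  rewrite -genU_full /genU -big_cat_nat //; lia.
rewrite [genU _ N.+1 p]genUl // mulrCA coef_genUl /= => /eqP.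
by rewrite mulNr subr_eq0 => /eqP->; rewrite mulrCA.
Qed.

End NestedSums.

(** * Coefficients of [T] in its two variables *)

Section SplitCoefficients.

Variable Q : comNzRingType.

Definition splitCoef (p : nat) (u v : nat -> Q) (r s : nat) : Q :=
  \sum_(1 <= n < p) v n * (genU u 1 n)`_r * (genU u n.+1 p)`_s.

Let lift2 (f : nat -> Q) (m : nat) : {poly {poly Q}} := (f m)%:P%:P.

(** Here [y] is the inner variable and [w] the outer one, whence the order of extraction. *)
Lemma coef_splitGen p (u v : nat -> Q) r s :
  (splitGen p (lift2 u) (lift2 v) 'X%:P 'X)`_s`_r = splitCoef p u v r s.
Proof.
rewrite /splitGen /splitCoef coef_sum coef_sum; apply: eq_bigr => n _.
have -> : \prod_(1 <= m < n) (1 + 'X%:P * lift2 u m) = (genU u 1 n)%:P.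
  rewrite /genU rmorph_prod; apply: eq_bigr => m _.
  by rewrite rmorphD rmorph1 /lift2 -polyCM mulrC mul_polyC.
have -> : \prod_(n.+1 <= m < p) (1 + 'X * lift2 u m) = map_poly polyC (genU u n.+1 p).
  rewrite /genU rmorph_prod; apply: eq_bigr => m _.
  by rewrite rmorphD rmorph1 /lift2 mulrC /= map_polyZ /= map_polyX -mul_polyC.
by rewrite /lift2 -polyCM coefCM coef_map /= coefMC coefCM.
Qed.

Lemma coef_genUN (u : nat -> Q) m n r :
  (genU (\- u) m n)`_r = (-1) ^+ r * (genU u m n)`_r.
Proof.
have [ltnm|] := ltnP n m.
  rewrite /genU !big_geq ?(ltnW ltnm) // coef1.
  by case: r => [|r]; rewrite ?mulr0 // expr0 mul1r.
elim: n r => [|n IHn] r.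
  rewrite leqn0 => /eqP->; rewrite /genU !big_geq // coef1.
  by case: r => [|r]; rewrite ?mulr0 // expr0 mul1r.
rewrite leq_eqVlt => /orP[/eqP<-|ltmn].
  rewrite /genU !big_geq // coef1.
  by case: r => [|r]; rewrite ?mulr0 // expr0 mul1r.
case: r => [|r]; first by rewrite !coef_genU0 expr0 mul1r.
by rewrite !coef_genUr // !IHn // exprS /=; ring.
Qed.

Lemma splitCoefN p (u v : nat -> Q) r s : ~~ odd (r + s) ->
  splitCoef p (\- u) v r s = splitCoef p u v r s.
Proof.
move=> even_rs; apply: eq_bigr => n _; rewrite !coef_genUN.
transitivity ((-1) ^+ (r + s) * (v n * (genU u 1 n)`_r * (genU u n.+1 p)`_s)).
  by rewrite exprD; ring.
by rewrite -signr_odd (negPf even_rs) expr0 mul1r.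
Qed.

Variables (p : nat) (pr_p : prime p) (odd_p : odd p) (iota : {rmorphism 'F_p -> Q}).
Variables (x : Q) (u v : nat -> Q).
Hypothesis x_nil : x ^+ p.-1 = 0.
Hypothesis uE : forall m, (0 < m < p)%N -> (m%:R - x) * u m = x.
Hypothesis vE : forall m, (0 < m < p)%N -> (m%:R - 2 * x) * v m = 2 * x.

(** Negating both variables amounts to negating [u], which preserves coefficients of even total
    degree. The 4 is the 2 of [splitGen_odd] times two equal contributions. *)
Lemma splitCoef_eq0 r s : ~~ odd (r + s) -> splitCoef p u v r s *+ 4 = 0.
Proof.
move=> even_rs.
pose iota2 : {rmorphism 'F_p -> {poly {poly Q}}} := polyC \o (polyC \o iota).
pose x2 : {poly {poly Q}} := x%:P%:P.
have x2_nil : x2 ^+ p.-1 = 0 by rewrite /x2 -!polyC_exp x_nil.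
have u2E m : (0 < m < p)%N -> (m%:R - x2) * lift2 u m = x2.
  move=> m_lt; rewrite /x2 -[in RHS](uE m_lt) !rmorphM !rmorphB /=.
  by rewrite !polyC_natr.
have v2E m : (0 < m < p)%N -> (m%:R - 2 * x2) * lift2 v m = 2 * x2.
  move=> m_lt; rewrite /x2 -!(polyC_natr _ 2) -!polyCM -[in RHS](vE m_lt).
  by rewrite !rmorphM !rmorphB /= !polyC_natr !rmorphM /= !polyC_natr.
have := splitGen_odd pr_p odd_p iota2 x2_nil u2E v2E 'X%:P 'X.
have -> : splitGen p (lift2 u) (lift2 v) (- 'X%:P) (- 'X) =
          splitGen p (lift2 (\- u)) (lift2 v) 'X%:P 'X.
  apply: eq_bigr => n _; congr (_ * _ * _); apply: eq_bigr => m _;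
    by rewrite /lift2 /= !polyCN mulrN mulNr.
move=> /(congr1 (fun q : {poly {poly Q}} => q`_s`_r)).
rewrite mulr_natl coefMn coefMn !coefD !coef_splitGen splitCoefN // !coef0.
by rewrite -mulr2n -mulrnA.
Qed.

Lemma genU_full_eq1 : genU (\- u) 1 p = 1.
Proof.
pose iota1 : {rmorphism 'F_p -> {poly Q}} := polyC \o iota.
have x1_nil : (x%:P : {poly Q}) ^+ p.-1 = 0 by rewrite -polyC_exp x_nil.
have u1E m : (0 < m < p)%N -> (m%:R - x%:P) * (u m)%:P = x%:P :> {poly Q}.
  by move=> m_lt; rewrite -[in RHS](uE m_lt) rmorphM rmorphB /= polyC_natr.
rewrite -[RHS](prod_u_eq1 pr_p odd_p iota1 x1_nil u1E (- 'X)).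
by apply: eq_bigr => m _; rewrite mulNr mulrC mul_polyC scaleNr.
Qed.

End SplitCoefficients.

(** * Truncated geometric series *)

Section TruncatedSeries.

Lemma coef_in_qpoly_eq0 (F : fieldType) k (q : {poly F}) :
  in_qpoly 'X^(k.+1) q = 0 -> q`_k = 0.
Proof.
move=> /(congr1 val) /=; rewrite mk_monic_Xn /= => q0.
rewrite [q](Pdiv.RingMonic.rdivp_eq (monicXn F k.+1)) q0 addr0.
by rewrite coefMXn ltnSn.
Qed.

Lemma in_qpolyXn (F : fieldType) k :
  in_qpoly 'X^(k.+1) 'X^(k.+1) = 0 :> {poly %/ 'X^(k.+1) : {poly F}}.
Proof.
by apply: val_inj; rewrite /= mk_monic_Xn /= Pdiv.RingMonic.rmodpp // monicXn.
Qed.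

(** The series [c X / (1 - c X)] up to degree [k]; the filtered sum over ['I_k.+1] matches the index
    type of the theorem. *)
Definition geom (F : fieldType) (k : nat) (c : F) : {poly F} :=
  \sum_(e < k.+1 | (0 < e)%N) (c *: 'X) ^+ e.

Lemma mul_geom (F : fieldType) (k : nat) (c : F) :
  (1 - c *: 'X) * geom k c = c *: 'X - c ^+ k.+1 *: 'X^(k.+1).
Proof.
set z := c *: 'X; have -> : geom k c = \sum_(e < k) z ^+ e.+1.
  by rewrite /geom big_mkcond big_ord_recl /= add0r.
transitivity (z * ((1 - z) * \sum_(e < k) z ^+ e)).
  by rewrite mulrCA; congr (_ * _); rewrite mulr_sumr; apply: eq_bigr => e _; rewrite exprS.
by rewrite -exprZn -/z -[1 - z]opprB mulNr -subrX1 exprS; ring.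
Qed.

Lemma coef_prod_geom (F : fieldType) (k d : nat) (a : 'I_d -> F) :
  (\prod_j geom k (a j))`_k =
  \sum_(c : {ffun 'I_d -> 'I_k.+1} | [forall j, (0 < c j)%N] && ((\sum_j c j)%N == k))
    \prod_j a j ^+ c j.
Proof.
rewrite /geom (bigA_distr_big (fun e : 'I_k.+1 => (0 < e)%N)) coef_sum.
under eq_bigr => c _.
  under eq_bigr do rewrite exprZn.
  rewrite scaler_prod prodrXr coefZ coefXn.
  over.
rewrite big_mkcond [RHS]big_mkcond /=; apply: eq_bigr => c _.
rewrite (_ : (c \in ffun_on _) = [forall j, (0 < c j)%N]) // eq_sym.
by case: (_ == k); rewrite ?andbT ?andbF ?mulr1 ?mulr0 // if_same.
Qed.

End TruncatedSeries.

(** * The weighted sums at one large prime *)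

Section PrimeCase.

Variables (p : nat) (pr_p : prime p) (k : nat).
Hypotheses (k_gt0 : (0 < k)%N) (ltkp : (k.+1 < p)%N).

Let Q : comNzRingType := {poly %/ 'X^(k.+1) : {poly 'F_p}}.
Let quo : {rmorphism {poly 'F_p} -> Q} := in_qpoly 'X^(k.+1).

Let odd_p : odd p.
Proof. by have [eq_p2|] := even_prime pr_p; first by move: ltkp; rewrite eq_p2; lia. Qed.

Let natFp_neq0 m : (0 < m < p)%N -> (m%:R : 'F_p) != 0.
Proof.
by case/andP=> m_gt0 ltmp; rewrite -(dvdn_pcharf (pchar_Fp pr_p)) gtnNdvd.
Qed.

(** In the quotient, [geom k (b / m)] plays the role of [b x / (m - b x)]: [b = 1] gives [u_m] and
    [b = 2] gives [v_m]. *)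
Let quo_geom (b : nat) m : (0 < m < p)%N ->
  (m%:R - b%:R * quo 'X) * quo (geom k (b%:R / m%:R)) = b%:R * quo 'X.
Proof.
move=> m_lt; have m_neq0 := natFp_neq0 m_lt.
have := congr1 (fun q => quo (m%:R * q)) (mul_geom k (b%:R / m%:R : 'F_p)).
rewrite mulrA mulrBr mulr1 mulrBr.
have -> : m%:R * ((b%:R / m%:R : 'F_p) *: 'X) = b%:R * 'X :> {poly 'F_p}.
  by rewrite -!polyC_natr -mul_polyC mulrA -polyCM mulrCA divff // mulr1.
rewrite rmorphM !rmorphB !rmorphM !rmorph_nat => ->.
rewrite -mul_polyC [quo (_ * _)]rmorphM /= in_qpolyXn.
by rewrite !mulr0 subr0.
Qed.

Let chainSum (e d : nat) (c : 'I_d -> nat) : 'F_p :=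
  \sum_(n : {ffun 'I_d -> 'I_p} | chain e n) \prod_j (n j)%:R ^- c j.

Lemma weighted_chainSum_eq0 e d (i : 'I_d) : (e <= 1)%N -> odd d ->
  \sum_(c : {ffun 'I_d -> 'I_k.+1} | [forall j, (0 < c j)%N] && ((\sum_j c j)%N == k))
    2 ^+ c i * chainSum e (fun j => c j) = 0.
Proof.
move=> e_le1 odd_d.
pose u m := geom k (m%:R^-1 : 'F_p); pose v m := geom k (2 / m%:R : 'F_p).
pose g j m := if j == i :> nat then v m else u m.
pose P := \sum_(n : {ffun 'I_d -> 'I_p} | chain e n) \prod_(j < d) g j (n j).
(* The weight [2 ^ c i] is absorbed by replacing [1 / n_i] with [2 / n_i]; expanding the geometric
   series then recovers the sum over exponents. *)
transitivity P`_k.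
  under eq_bigr do rewrite mulr_sumr.
  rewrite exchange_big coef_sum; apply: eq_bigr => n _.
  pose a (j : 'I_d) : 'F_p := (if j == i then 2 else 1) / (n j)%:R.
  rewrite (eq_bigr (fun j => geom k (a j))); last first.
    by move=> j _; rewrite /g /a -val_eqE /=; case: ifP => //; rewrite div1r.
  rewrite coef_prod_geom; apply: eq_bigr => c _.
  under [RHS]eq_bigr do rewrite exprMn exprVn.
  rewrite big_split; congr (_ * _).
  rewrite (bigD1 i) //= eqxx big1 ?mulr1 // => j /negPf->.
  by rewrite expr1n.
have n4 : (4%:R : 'F_p) != 0.
  rewrite (natrM _ 2 2) mulf_neq0 // natFp_neq0 //; lia.
suff /eqP : P`_k *+ 4 = 0 by rewrite -mulr_natl mulf_eq0 (negPf n4) => /eqP.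
rewrite -coefMn; apply: coef_in_qpoly_eq0; rewrite -[LHS]/(quo _) rmorphMn /=.
pose g' j m := if j == i :> nat then quo (v m) else quo (u m).
have -> : quo P = nest e g' (i.+1 + (d - i.+1)) p.
  rewrite subnKC // -sum_chain // rmorph_sum; apply: eq_bigr => n _.
  by rewrite rmorph_prod; apply: eq_bigr => j _; rewrite /g /g'; case: ifP.
set s := (d - i.+1)%N.
have even_is : ~~ odd (i + s).
  by move: odd_d; rewrite -[in odd d](subnKC (ltn_ord i)) addSn.
pose iota : {rmorphism 'F_p -> Q} := quo \o polyC.
have x_nil : quo 'X ^+ p.-1 = 0.
  rewrite -rmorphXn -(subnK (_ : k.+1 <= p.-1)%N); last by lia.
  by rewrite exprD rmorphM /= in_qpolyXn mulr0.
have uE m : (0 < m < p)%N -> (m%:R - quo 'X) * quo (u m) = quo 'X.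
  by move=> /(quo_geom 1); rewrite !mul1r.
have vE m : (0 < m < p)%N -> (m%:R - 2 * quo 'X) * quo (v m) = 2 * quo 'X.
  exact: quo_geom.
case: e e_le1 {P} => [|[|//]] _.
  by rewrite nest_strict (splitCoef_eq0 pr_p odd_p iota x_nil uE vE).
rewrite (nest_weak _ _ (genU_full_eq1 pr_p odd_p iota x_nil uE)); last by lia.
(* At [N = p] the range [[N, p)] is empty, so the weak sum is a [splitCoef] of [\- u] with [i] and
   [s] exchanged. *)
rewrite (eq_bigr (fun n => quo (v n) * (genU (\- (quo \o u)) 1 n)`_s
    * (genU (\- (quo \o u)) n.+1 p)`_i)); last first.
  by move=> n _; rewrite [genU _ p p]/genU big_geq // mulr1 mulrAC.
have even_si : ~~ odd (s + i) by rewrite addnC.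
rewrite -[X in X *+ _]/(splitCoef p (\- (quo \o u)) (quo \o v) s i) splitCoefN //.
exact: (splitCoef_eq0 pr_p odd_p iota x_nil uE vE).
Qed.

End PrimeCase.

(** * Passage to the quotient ring *)

Lemma prodF_sumE (I : Type) (r : seq I) (P : pred I) (x : I -> prodF) q :
  (\sum_(j <- r | P j) x j) q = \sum_(j <- r | P j) x j q.
Proof. by elim/big_rec2: _ => // j y z _ <-. Qed.

Lemma prodF_natXE (m n : nat) q : ((m%:R : prodF) ^+ n) q = m%:R ^+ n.
Proof.
elim: n => // n IHn; rewrite !exprS -IHn.
rewrite -[LHS]/((m%:R : prodF) q * _); congr (_ * _).
by elim: m {IHn} => // m IHm; rewrite -!natr1 -IHm.
Qed.

Lemma pi_prodF_eq0 (x : prodF) N :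
  (forall q : prime_nat, (N < sval q)%N -> x q = 0) -> \pi_calA%qT x = 0.
Proof.
move=> x0; suff x_sum : x \in sumF.
  rewrite -[RHS](raddf0 (\pi_calA%qT : {additive prodF -> calA})).
  by apply/eqP; rewrite -Quotient.idealrBE subr0.
apply/asboolP; apply: (@sub_finite_set _ _ (sval @^-1` `I_N.+1)%classic).
  move=> q /=; apply: contra_notT; rewrite -leqNgt; exact: x0.
apply: finite_preimage (finite_II _) => q q' _ _; exact: val_inj.
Qed.

Theorem theorem1p2 (k d : nat) (i : 'I_d) (hk : (0 < k)%N) (hd : odd d) :
  \sum_(c : {ffun 'I_d -> 'I_k.+1} |
      [forall j, (0 < c j)%N] && ((\sum_j c j)%N == k))
    2 ^+ c i * zetaA (fun j => c j) = 0
  /\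
  \sum_(c : {ffun 'I_d -> 'I_k.+1} |
      [forall j, (0 < c j)%N] && ((\sum_j c j)%N == k))
    2 ^+ c i * zetaAstar (fun j => c j) = 0.
Proof.
pose pi : {rmorphism prodF -> calA} := \pi_calA%qT.
have reduce (e : nat) (h : forall p d, ('I_d -> nat) -> 'F_p) : (e <= 1)%N ->
    (forall p d (c : 'I_d -> nat), h p d c =
       \sum_(n : {ffun 'I_d -> 'I_p} | chain e n) \prod_j (n j)%:R ^- c j) ->
    \sum_(c : {ffun 'I_d -> 'I_k.+1} |
        [forall j, (0 < c j)%N] && ((\sum_j c j)%N == k))
      2 ^+ c i * pi (fun q => h (sval q) d (fun j => c j)) = 0.
  move=> e_le1 hE; under eq_bigr do rewrite -[2](rmorph_nat pi) -rmorphXn -rmorphM.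
  (* Only the primes above [k + 1] matter; the remaining ones are finitely many. *)
  rewrite -rmorph_sum; apply: (@pi_prodF_eq0 _ k.+1) => q ltkq.
  rewrite prodF_sumE -[RHS](weighted_chainSum_eq0 (svalP q) hk ltkq i e_le1 hd).
  by apply: eq_bigr => c _; rewrite -hE -prodF_natXE.
split.
  apply: (reduce 0) => // p d' c; apply: eq_bigl => n; congr (_ && _).
  by do 2!apply: eq_forallb => ?; rewrite addn0.
apply: (reduce 1) => // p d' c; apply: eq_bigl => n; congr (_ && _).
by do 2!apply: eq_forallb => ?; rewrite addn1 ltnS.
Qed.
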